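(* Let $c\in(1,\infty)$. Let $\mathcal Q$ be a family of irreducible aperiodic Markov kernels on a finite set $V$, $c$-stable with respect to a positive probability measure $\mu_0$. Let $(K_i)_{i\ge1}$ be a sequence with $K_i\in\mathcal Q$ for all $i$, set $\mu_n=\mu_0K_{0,n}$, let $\pi_i$ be the invariant probability measure of $K_i$, let $\sigma_1(K_i)$ be the second largest singular value of $K_i:\ell^2(\pi_i)\to\ell^2(\pi_i)$, and let $l(K_i^*K_i)$ be the logarithmic Sobolev constant of $K_i^*K_i$, where $K_i^*$ is the adjoint of $K_i:\ell^2(\pi_i)\to\ell^2(\pi_i)$. For $x\in V$ let \[\tilde m_x=\min\Bigl\{t\in\mathbb N:\sum_{i=1}^t\log\bigl(1+c^{-4}l(K_i^*K_i)\bigr)\ge\log\log\bigl(\mu_0(x)^{-1/2}\bigr)\Bigr\}.\] Then for $n\ge\tilde m_x$, \[d_2(K_{0,n}(x,\cdot),\mu_n)^2\le e^2\prod_{i=\tilde m_x+1}^n\Bigl(1-c^{-4}\bigl(1-\sigma_1(K_i)^2\bigr)\Bigr).\]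
   Context: $K_{0,n}=K_1\cdots K_n$. A family $\mathcal Q$ is $c$-stable w.r.t. $\mu_0$ if every sequence from $\mathcal Q$ satisfies $c^{-1}\le\mu_n(x)/\mu_0(x)\le c$ for all $n\ge0$, $x$. $K_i^*K_i$ has kernel $\frac{1}{\pi_i(x)}\sum_z\pi_i(z)K_i(z,x)K_i(z,y)$. For $P$ reversible w.r.t. $\nu$: $\mathcal E_{P,\nu}(f,f)=\frac12\sum_{x,y}|f(x)-f(y)|^2\nu(x)P(x,y)$, $\mathcal L(f^2,\nu)=\sum_xf^2\log(f^2/\|f\|^2_{\ell^2(\nu)})\nu(x)$, $l(P)=\inf\{\mathcal E_{P,\nu}(f,f)/\mathcal L(f^2,\nu):\mathcal L(f^2,\nu)\ne0,\ f\text{ nonconstant}\}$. $d_2(K_{0,n}(x,\cdot),\mu_n)=(\sum_y|K_{0,n}(x,y)/\mu_n(y)-1|^2\mu_n(y))^{1/2}$. *)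

(* Defs.v *)
From HB Require Import structures.
From mathcomp Require Import all_boot all_order all_algebra.
From mathcomp Require Import classical_sets reals sequences exp.
Set Implicit Arguments. Unset Strict Implicit. Unset Printing Implicit Defensive.
Import Order.TTheory GRing.Theory Num.Theory.
Local Open Scope ring_scope.

Section Defs.
Variables (R : realType) (V : finType).

Definition kernel := V -> V -> R.

Definition markov (K : kernel) : Prop :=
  (forall x y, 0 <= K x y) /\ (forall x, \sum_y K x y = 1).

Definition kmul (K L : kernel) : kernel := fun x y => \sum_z K x z * L z y.
Definition kid : kernel := fun x y => (x == y)%:R.
Definition kpow (K : kernel) (n : nat) : kernel := iter n (fun P => kmul P K) kid.

Definition irreducible (K : kernel) : Prop :=
  forall x y, exists n, 0 < kpow K n x y.

Definition aperiodic (K : kernel) : Prop :=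
  forall x (d : nat), (forall n, (0 < n)%N -> 0 < kpow K n x x -> (d %| n)%N) -> d = 1%N.

Definition pos_prob (mu : V -> R) : Prop :=
  (forall x, 0 < mu x) /\ \sum_x mu x = 1.

Definition invariant_prob (K : kernel) (pi : V -> R) : Prop :=
  (forall x, 0 <= pi x) /\ \sum_x pi x = 1 /\ (forall y, \sum_x pi x * K x y = pi y).

(* K_{0,n} = K_1 ... K_n  (K 0 unused) *)
Fixpoint Kprod (K : nat -> kernel) (n : nat) : kernel :=
  match n with
  | 0 => kid
  | n'.+1 => kmul (Kprod K n') (K n)
  end.

Definition mun (mu0 : V -> R) (K : nat -> kernel) (n : nat) : V -> R :=
  fun y => \sum_x mu0 x * Kprod K n x y.

Definition c_stable (Q : kernel -> Prop) (mu0 : V -> R) (c : R) : Prop :=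
  forall K : nat -> kernel, (forall i, (1 <= i)%N -> Q (K i)) ->
  forall n x, c^-1 <= mun mu0 K n x / mu0 x <= c.

Definition kstar_k (K : kernel) (pi : V -> R) : kernel :=
  fun x y => (pi x)^-1 * \sum_z pi z * K z x * K z y.

Definition dirichlet (P : kernel) (nu : V -> R) (f : V -> R) : R :=
  2^-1 * \sum_x \sum_y (f x - f y) ^+ 2 * nu x * P x y.

Definition norm2sq (nu : V -> R) (f : V -> R) : R := \sum_x f x ^+ 2 * nu x.

Definition entL (nu : V -> R) (f : V -> R) : R :=
  \sum_x f x ^+ 2 * ln (f x ^+ 2 / norm2sq nu f) * nu x.

Definition nonconstant (f : V -> R) : Prop := exists x y, f x != f y.

Definition logsob (P : kernel) (nu : V -> R) : R :=
  inf [set dirichlet P nu f / entL nu f | f in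
        [set f : V -> R | entL nu f != 0 /\ nonconstant f]]%classic.

(* s is the second largest singular value of K : l^2(pi) -> l^2(pi):
   s = sqrt(lambda_1) where lambda_0 >= lambda_1 >= ... are the eigenvalues
   (with multiplicity) of K^*K, given by an l^2(pi)-orthonormal eigenbasis.
   Convention s = 0 if #|V| < 2. *)
Definition second_sv (K : kernel) (pi : V -> R) (s : R) : Prop :=
  exists (e : nat -> V -> R) (lam : nat -> R),
    (forall i j, (i < #|V|)%N -> (j < #|V|)%N ->
       \sum_v e i v * e j v * pi v = (i == j)%:R) /\
    (forall j, (j < #|V|)%N -> forall v,
       \sum_w kstar_k K pi v w * e j w = lam j * e j v) /\
    (forall i j, (i <= j)%N -> (j < #|V|)%N -> lam j <= lam i) /\
    s = (if (1 < #|V|)%N then Num.sqrt (lam 1%N) else 0).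

Definition lsum (c : R) (K : nat -> kernel) (pi : nat -> V -> R) (t : nat) : R :=
  \sum_(1 <= i < t.+1) ln (1 + c ^- 4 * logsob (kstar_k (K i) (pi i)) (pi i)).

Definition mcond (c : R) (K : nat -> kernel) (pi : nat -> V -> R) (mu0 : V -> R)
  (x : V) (t : nat) : Prop :=
  ln (ln ((Num.sqrt (mu0 x))^-1)) <= lsum c K pi t.

Definition is_mtilde (c : R) (K : nat -> kernel) (pi : nat -> V -> R) (mu0 : V -> R)
  (x : V) (m : nat) : Prop :=
  mcond c K pi mu0 x m /\ (forall t, (t < m)%N -> ~ mcond c K pi mu0 x t).

Definition d2 (k : V -> R) (mu : V -> R) : R :=
  Num.sqrt (\sum_y `|k y / mu y - 1| ^+ 2 * mu y).

End Defs.

(* Main.v *)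
(* Miclo's hypercontractivity argument, carried out along the inhomogeneous chain.
   Stability keeps every mu_n and every invariant measure pi_i within a factor c
   of mu_0, hence within a factor c^2 of each other, so the logarithmic Sobolev and
   spectral gap inequalities of K_i^* K_i on l^2(pi_i) pass to K_i, seen as an
   operator l^2(mu_i) -> l^2(mu_(i-1)), at the price of c^-4. The log-Sobolev
   inequalities make K_(0,n) a contraction l^2(mu_n) -> l^q(mu_0) with
   q = 2 prod_i (1 + c^-4 l(K_i^* K_i)); evaluating at the atom x, the density
   of K_(0,m)(x, .) has squared l^2 norm at most mu_0(x)^(-2/q) <= e^2 at time
   m = m~_x. From then on, the density minus 1 evolves by the adjoints of the K_i,
   which contract centered functions by the spectral gap. *)
Require Import Defs.
From HB Require Import structures.
From mathcomp Require Import all_boot all_order all_algebra.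
From mathcomp Require Import ring lra.
From mathcomp Require Import boolp classical_sets reals sequences exp.
Set Implicit Arguments.
Unset Strict Implicit.
Unset Printing Implicit Defensive.
Import Order.TTheory GRing.Theory Num.Theory.
Local Open Scope ring_scope.


(** * Averages and Markov operators *)

Section Averages.
Variables (R : realType) (V : finType).
Implicit Types (K L : kernel R V) (nu mu f g : V -> R).

Definition avg nu f : R := \sum_x nu x * f x.
Definition act K f : V -> R := fun x => avg (K x) f.
Definition push nu K : V -> R := fun y => \sum_x nu x * K x y.

Lemma eq_avg nu f g : f =1 g -> avg nu f = avg nu g.
Proof. by move=> fg; apply: eq_bigr => x _; rewrite fg. Qed.

Lemma eq_avgl nu mu f : nu =1 mu -> avg nu f = avg mu f.
Proof. by move=> fg; apply: eq_bigr => x _; rewrite fg. Qed.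

Lemma avgD nu f g : avg nu (fun x => f x + g x) = avg nu f + avg nu g.
Proof. by rewrite -big_split; apply: eq_bigr => x _; rewrite mulrDr. Qed.

Lemma avgZ nu a f : avg nu (fun x => a * f x) = a * avg nu f.
Proof. by rewrite mulr_sumr; apply: eq_bigr => x _; rewrite mulrCA. Qed.

Lemma avgB nu f g : avg nu (fun x => f x - g x) = avg nu f - avg nu g.
Proof. by rewrite -sumrB; apply: eq_bigr => x _; rewrite mulrBr. Qed.

Lemma avg_cst nu a : avg nu (fun=> a) = a * \sum_x nu x.
Proof. by rewrite /avg -mulr_suml mulrC. Qed.

Lemma ler_avg nu f g : (forall x, 0 <= nu x) -> (forall x, f x <= g x) ->
  avg nu f <= avg nu g.
Proof. by move=> nu0 fg; apply: ler_sum => x _; exact: ler_wpM2l. Qed.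

Lemma ler_avgl nu mu f : (forall x, nu x <= mu x) -> (forall x, 0 <= f x) ->
  avg nu f <= avg mu f.
Proof. by move=> nm f0; apply: ler_sum => x _; exact: ler_wpM2r. Qed.

Lemma avg_ge0 nu f : (forall x, 0 <= nu x) -> (forall x, 0 <= f x) ->
  0 <= avg nu f.
Proof. by move=> nu0 f0; apply: sumr_ge0 => x _; exact: mulr_ge0. Qed.

Lemma avg_gt0 nu f : (forall x, 0 <= nu x) -> \sum_x nu x = 1 ->
  (forall x, 0 < f x) -> 0 < avg nu f.
Proof.
move=> nu0 nu1 f0; have f0' x : 0 <= f x by exact: ltW.
rewrite lt0r avg_ge0 ?andbT//.
apply/negP; rewrite psumr_eq0 => [/allP nuf0|x _]; last by rewrite mulr_ge0.
suff : (1 : R) == 0 by rewrite oner_eq0.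
rewrite -nu1 big1// => x _; have := nuf0 x; rewrite mem_index_enum => /(_ isT).
by rewrite mulf_eq0 [f x == 0]gt_eqF ?orbF//= => /eqP.
Qed.

Lemma avg_push nu K f : avg (push nu K) f = avg nu (act K f).
Proof.
rewrite /avg /push.
under eq_bigr do rewrite mulr_suml.
rewrite exchange_big; apply: eq_bigr => x _; rewrite mulr_sumr.
by apply: eq_bigr => y _; rewrite mulrA.
Qed.

Lemma sum_avg nu : \sum_x nu x = avg nu (fun=> 1).
Proof. by rewrite avg_cst mul1r. Qed.

Lemma act_cst K a z : markov K -> act K (fun=> a) z = a.
Proof. by case=> _ K1; rewrite /act avg_cst K1 mulr1. Qed.

Lemma sum_push nu K : markov K -> \sum_y push nu K y = \sum_x nu x.
Proof.
by move=> mK; rewrite !sum_avg avg_push; apply: eq_avg => z; rewrite act_cst.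
Qed.

Lemma act_kmul K L f z : act (kmul K L) f z = act K (act L f) z.
Proof. by rewrite /act -avg_push. Qed.

Lemma act_kid f z : act (@kid R V) f z = f z.
Proof.
rewrite /act /avg (bigD1 z)//= /kid eqxx mul1r big1 ?addr0// => y.
by rewrite eq_sym => /negPf ->; rewrite mul0r.
Qed.

Lemma ler_act K f g z : markov K -> (forall x, f x <= g x) ->
  act K f z <= act K g z.
Proof. by case=> K0 _; exact: ler_avg. Qed.

Lemma act_gt0 K f z : markov K -> (forall x, 0 < f x) -> 0 < act K f z.
Proof. by case=> K0 K1; apply: avg_gt0. Qed.

Lemma markov_kid : markov (@kid R V).
Proof.
split=> [x y|x]; first by rewrite ler0n.
by rewrite sum_avg; exact: act_kid.
Qed.

Lemma markov_kmul K L : markov K -> markov L -> markov (kmul K L).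
Proof.
move=> mK mL; have [[K0 _] [L0 _]] := (mK, mL); split=> [x y|x].
  by apply: avg_ge0.
rewrite sum_avg -/(act (kmul K L) _ x) act_kmul -[RHS](act_cst 1 x mK).
by apply: eq_avg => y; rewrite act_cst.
Qed.

Lemma markov_kpow K n : markov K -> markov (kpow K n).
Proof.
by move=> mK; elim: n => [|n IH]; [exact: markov_kid|exact: markov_kmul].
Qed.

Lemma markov_Kprod (Ks : nat -> kernel R V) n :
  (forall i, (0 < i)%N -> markov (Ks i)) -> markov (Kprod Ks n).
Proof.
move=> mK; elim: n => [|n IH]; first exact: markov_kid.
by apply: markov_kmul => //; exact: mK.
Qed.

Lemma avg_mun mu (Ks : nat -> kernel R V) n f :
  avg (mun mu Ks n) f = avg mu (act (Kprod Ks n) f).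
Proof. exact: avg_push. Qed.

Lemma munS mu (Ks : nat -> kernel R V) n :
  mun mu Ks n.+1 =1 push (mun mu Ks n) (Ks n.+1).
Proof.
by move=> y; rewrite /push -/(avg _ (fun x => Ks n.+1 x y)) avg_mun.
Qed.

Lemma mun0 mu (Ks : nat -> kernel R V) : mun mu Ks 0 =1 mu.
Proof.
move=> y; rewrite /mun /= (bigD1 y)//= /kid eqxx mulr1 big1 ?addr0// => x.
by move=> /negPf ->; rewrite mulr0.
Qed.

Lemma mun_sum1 mu (Ks : nat -> kernel R V) n :
  (forall i, (0 < i)%N -> markov (Ks i)) -> \sum_x mu x = 1 ->
  \sum_x mun mu Ks n x = 1.
Proof. by move=> mK <-; apply: sum_push; exact: markov_Kprod. Qed.

Lemma act_pow_fix K f n z : act K f =1 f -> act (kpow K n) f z = f z.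
Proof.
move=> Kf; elim: n z => [|n IH] z; first exact: act_kid.
by rewrite act_kmul -[RHS]IH; apply: eq_avg => y; rewrite Kf.
Qed.

(** Maximum principle: at a maximizer [w] of [f], the nonnegative function [f w - f] has average 0
    under [kpow K n w], so it vanishes wherever that kernel charges; irreducibility reaches every
    point. *)
Lemma harmonic_const K f x y : markov K -> irreducible K -> act K f =1 f ->
  f x = f y.
Proof.
move=> mK iK Kf; have [w _ fw] := @arg_maxP _ _ _ x predT f isT.
suff E z : f z = f w by rewrite !E.
have [n Kn] := iK w z; have [Kn0 Kn1] := markov_kpow n mK.
have : avg (kpow K n w) (fun y => f w - f y) = 0.
  by rewrite avgB avg_cst Kn1 mulr1 -/(act _ _ w) act_pow_fix// subrr.
move/eqP; rewrite psumr_eq0 => [|y0 _]; last first.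
  by rewrite mulr_ge0// subr_ge0; exact: fw.
move=> /allP /(_ z); rewrite mem_index_enum => /(_ isT) /=.
by rewrite mulf_eq0 gt_eqF//= subr_eq0 => /eqP ->.
Qed.

Lemma injective_solvable (A : kernel R V) :
  (forall f, act A f =1 (fun=> 0) -> f =1 (fun=> 0)) ->
  forall g, exists f, act A f =1 g.
Proof.
move=> Ainj g.
pose M : 'M[R]_#|V| := \matrix_(i, j) A (enum_val j) (enum_val i).
have sumV (F : V -> R) : \sum_x F x = \sum_(i < #|V|) F (enum_val i).
  by rewrite -big_enum_val.
pose fn (v : 'rV[R]_#|V|) (y : V) := v 0 (enum_rank y).
have fnM v y : (v *m M) 0 (enum_rank y) = act A (fn v) y.
  rewrite mxE /act /avg sumV; apply: eq_bigr => i _.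
  by rewrite mxE /fn enum_rankK enum_valK mulrC.
have Mu : M \in unitmx.
  rewrite -row_free_unit; apply: inj_row_free => v vM.
  apply/rowP => i; rewrite mxE -(enum_valK i); apply: (Ainj (fn v)) => y.
  by rewrite -fnM vM mxE.
exists (fn ((\row_i g (enum_val i)) *m invmx M)) => y.
by rewrite -fnM mulmxKV// mxE enum_rankK.
Qed.

(** [I - K] kills the constants, so the rank-one map [f |-> avg pi f] is added to make it injective:
    [A f = 0] forces [avg pi f = 0], then [f] is harmonic, hence constant, hence 0. Injectivity
    gives solvability in finite dimension. *)
Lemma poisson_equation K (pi : V -> R) g : markov K -> irreducible K ->
  invariant_prob K pi ->
  exists f, forall x, f x - act K f x = g x - avg pi g.
Proof.
move=> mK iK [pi0 [pi1 piK]].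
have piK' f : avg pi (act K f) = avg pi f by rewrite -avg_push; exact: eq_avgl.
pose A : kernel R V := fun x y => (x == y)%:R - K x y + pi y.
have actA f x : act A f x = f x - act K f x + avg pi f.
  rewrite -{1}(act_kid f x) -sumrB -big_split; apply: eq_bigr => y _.
  by rewrite /A mulrDl mulrBl.
have avgA f : avg pi (act A f) = avg pi f.
  under eq_avg do rewrite actA.
  by rewrite avgD avgB piK' subrr add0r avg_cst pi1 mulr1.
have Ainj f : act A f =1 (fun=> 0) -> f =1 (fun=> 0).
  move=> Af; have pf : avg pi f = 0.
    by rewrite -avgA (eq_avg _ Af) avg_cst mul0r.
  have Kf : act K f =1 f.
    by move=> x; have := Af x; rewrite actA pf addr0 => /subr0_eq.
  move=> x; rewrite -pf -[LHS]mulr1 -pi1 -avg_cst.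
  by apply: eq_avg => y; exact: harmonic_const Kf.
have [f Af] := injective_solvable Ainj (fun x => g x - avg pi g).
(* The right-hand side is centered and [A] preserves [avg pi], so [avg pi f = 0] and the added
   rank-one term disappears. *)
exists f => x; rewrite -Af actA -avgA (eq_avg _ Af) avgB avg_cst pi1.
by rewrite mulr1 subrr addr0.
Qed.

Lemma bounded_multiples_le0 (a B : R) : (forall N : nat, N%:R * a <= B) -> a <= 0.
Proof.
move=> aB; rewrite leNgt; apply/negP => a0.
have := aB (Num.bound (B / a)); rewrite leNgt -ltr_pdivrMr//.
have B0 : 0 <= B by have := aB 0%N; rewrite mul0r.
by rewrite archi_boundP// divr_ge0// ltW.
Qed.
End Averages.

(** * Comparison of invariant and running measures *)

Section Stationary.
Variables (R : realType) (V : finType).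
Implicit Types (K L : kernel R V) (nu mu f g : V -> R).

(* Through a solution of the Poisson equation the sums [avg (mu K^n) g - avg pi g]
   telescope, so they stay bounded in [N] and the bound [B] passes to [pi]. *)
Lemma stationary_avg_le K (pi mu : V -> R) g B : markov K -> irreducible K ->
  invariant_prob K pi -> (forall x, 0 <= mu x) -> \sum_x mu x = 1 ->
  (forall n, avg (mun mu (fun=> K) n) g <= B) -> avg pi g <= B.
Proof.
move=> mK iK piK mu_ge0 mu1 gB; rewrite -subr_le0.
have [f fE] := poisson_equation g mK iK piK.
pose nu n := mun mu (fun=> K) n.
have nu1 n : \sum_x nu n x = 1 by exact: mun_sum1.
have nu_ge0 n x : 0 <= nu n x.
  apply: avg_ge0 => // y.
  by have [] := @markov_Kprod _ _ (fun=> K) n (fun i _ => mK).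
have step n : avg pi g - avg (nu n) g = avg (nu n.+1) f - avg (nu n) f.
  rewrite (eq_avgl _ (munS _ _ _)) avg_push -avgB.
  rewrite -[avg pi g]mulr1 -(nu1 n) -avg_cst -avgB; apply: eq_avg => x.
  by rewrite -[LHS]opprB -fE opprB.
have sumE (N : nat) : N%:R * (avg pi g - B) <= avg (nu N) f - avg (nu 0%N) f.
  elim: N => [|N IH]; first by rewrite mul0r subrr.
  rewrite -natr1 mulrDl mul1r.
  have := gB N; rewrite -/(nu N) => gN; have := step N; lra.
have bnd n : `|avg (nu n) f| <= \sum_x `|f x|.
  apply: (le_trans (ler_norm_sum _ _ _)); apply: ler_sum => x _.
  rewrite normrM (ger0_norm (nu_ge0 n x)) ler_piMl// -(nu1 n).
  by rewrite (bigD1 x)//= lerDl sumr_ge0.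
apply: (@bounded_multiples_le0 _ _ (2 * \sum_x `|f x|)) => N.
apply: (le_trans (sumE N)); have := bnd N; have := bnd 0%N.
rewrite !ler_norml; lra.
Qed.

(** Stability applied to the constant sequence [K, K, ...] bounds the mass at [y] uniformly in time,
    and such bounds pass to [pi]. *)
Lemma stationary_bounds (Q : kernel R V -> Prop) mu (c : R) K pi :
  pos_prob mu -> c_stable Q mu c -> Q K -> markov K -> irreducible K ->
  invariant_prob K pi ->
  forall y, c^-1 * mu y <= pi y /\ pi y <= c * mu y.
Proof.
move=> [mu_gt0 mu1] stab QK mK iK piK y.
have mu_ge0 x : 0 <= mu x by exact: ltW.
have bnd n := stab (fun=> K) (fun _ _ => QK) n y.
have dirac nu : avg nu (fun x => (x == y)%:R) = nu y.
  rewrite /avg (bigD1 y)//= eqxx mulr1 big1 ?addr0// => x /negPf ->.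
  by rewrite mulr0.
split; last first.
  rewrite -[pi y]dirac; apply: (stationary_avg_le mK iK piK) => // n.
  by rewrite dirac -ler_pdivrMr//; case/andP: (bnd n).
(* The lower bound is the upper bound for minus the indicator of [y]. *)
rewrite -lerN2 -[pi y]dirac -mulN1r -avgZ.
apply: (stationary_avg_le mK iK piK) => // n.
rewrite avgZ dirac mulN1r lerN2 -ler_pdivlMr//; by case/andP: (bnd n).
Qed.

End Stationary.

(** * Local variance and the Dirichlet form of [K^*K] *)

Section LocalVariance.
Variables (R : realType) (V : finType).
Implicit Types (K L : kernel R V) (nu mu pi f g : V -> R).

(** Its average under [mu] is the squared norm lost in passing from [f] in [l^2(push mu K)] to
    [act K f] in [l^2(mu)], which makes sense without any invariance of [mu]. *)
Definition lvar K f z := act K (fun y => f y ^+ 2) z - act K f z ^+ 2.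

Lemma lvarE K f z : markov K ->
  lvar K f z = 2^-1 * \sum_x \sum_y (f x - f y) ^+ 2 * (K z x * K z y).
Proof.
move=> [_ K1].
have E x : \sum_y (f x - f y) ^+ 2 * (K z x * K z y) =
    K z x * (f x ^+ 2 - 2 * act K f z * f x + act K (fun y => f y ^+ 2) z).
  transitivity (K z x * avg (K z) (fun y => f x ^+ 2 + (- 2 * f x) * f y + f y ^+ 2)).
    by rewrite mulr_sumr; apply: eq_bigr => y _; ring.
  by rewrite !avgD avg_cst avgZ K1 /act; ring.
rewrite (eq_bigr _ (fun x _ => E x)).
rewrite -/(avg (K z) (fun x => _)) avgD avgB avgZ avg_cst K1 /lvar /act.
by field.
Qed.

Lemma lvar_ge0 K f z : markov K -> 0 <= lvar K f z.
Proof.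
move=> mK; rewrite lvarE// mulr_ge0// ?invr_ge0// sumr_ge0// => x _.
by rewrite sumr_ge0// => y _; rewrite mulr_ge0 ?sqr_ge0// mulr_ge0//; case: mK.
Qed.

Lemma avg_lvar mu K f :
  avg mu (lvar K f) =
  avg (push mu K) (fun y => f y ^+ 2) - avg mu (fun z => act K f z ^+ 2).
Proof. by rewrite avg_push -avgB. Qed.

Lemma dirichletE K pi f : markov K -> (forall x, 0 < pi x) ->
  dirichlet (kstar_k K pi) pi f = avg pi (lvar K f).
Proof.
move=> mK pi0; rewrite /dirichlet.
rewrite (eq_avg pi (g := fun z =>
  2^-1 * \sum_x \sum_y (f x - f y) ^+ 2 * (K z x * K z y))).
  2: by move=> z; exact: lvarE.
rewrite avgZ; congr (_ * _); rewrite /avg.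
under [RHS]eq_bigr do rewrite mulr_sumr.
rewrite [RHS]exchange_big; apply: eq_bigr => x _.
under [RHS]eq_bigr do rewrite mulr_sumr.
rewrite [RHS]exchange_big; apply: eq_bigr => y _.
rewrite /kstar_k mulrA mulfK ?gt_eqF// mulr_sumr.
by apply: eq_bigr => z _; ring.
Qed.

Lemma dirichlet_ge0 K pi f : markov K -> (forall x, 0 < pi x) ->
  0 <= dirichlet (kstar_k K pi) pi f.
Proof.
move=> mK pi0; rewrite dirichletE//; apply: avg_ge0 => z; first exact: ltW.
exact: lvar_ge0.
Qed.

(** As [lvar K f] is nonnegative and does not involve the measure, changing the measure affects only
    the outer weight and costs a single factor [C]. *)
Lemma dirichlet_compare K pi mu C f : markov K -> (forall x, 0 < pi x) ->
  (forall x, pi x <= C * mu x) ->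
  dirichlet (kstar_k K pi) pi f <= C * avg mu (lvar K f).
Proof.
move=> mK pi0 piC; rewrite dirichletE//.
apply: (@le_trans _ _ (avg (fun x => C * mu x) (lvar K f))).
  by apply: ler_avgl => // z; exact: lvar_ge0.
by rewrite /avg mulr_sumr; under eq_bigr do rewrite -mulrA.
Qed.

End LocalVariance.

(** * Entropy and logarithmic Sobolev inequalities under change of measure *)

Section Entropy.
Variables (R : realType) (V : finType).
Implicit Types (K L : kernel R V) (nu mu pi f g : V -> R).

(* The integrand of the variational formula
   [Ent_nu (g) = min_a avg nu (ent_gap a g)], attained at [a = avg nu g]. *)
Definition ent_gap (a t : R) := t * ln (t / a) - t + a.

Lemma ln_le_sub1 (x : R) : 0 < x -> ln x <= x - 1.
Proof. by move=> x0; have := @le_ln1Dx R (x - 1); rewrite subrKC; apply; lra. Qed.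

Lemma ent_gap_ge0 a t : 0 < a -> 0 <= t -> 0 <= ent_gap a t.
Proof.
rewrite /ent_gap => a0; rewrite le_eqVlt => /predU1P[<-|t0].
  by rewrite mul0r subr0 add0r ltW.
have := ln_le_sub1 (divr_gt0 a0 t0); rewrite -(ler_pM2l t0).
rewrite -[a / t]invf_div lnV ?posrE ?divr_gt0// mulrBr mulr1 invf_div.
rewrite mulrCA divff ?gt_eqF// mulr1 mulrN; lra.
Qed.

Lemma entLE nu f : \sum_x nu x = 1 ->
  entL nu f = avg nu (fun x => ent_gap (norm2sq nu f) (f x ^+ 2)).
Proof.
move=> nu1; rewrite /ent_gap avgD avgB avg_cst nu1 mulr1.
have -> : avg nu (fun x => f x ^+ 2) = norm2sq nu f.
  by apply: eq_bigr => x _; rewrite mulrC.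
by rewrite subrK; apply: eq_bigr => x _; rewrite mulrC.
Qed.

Lemma norm2sq_ge0 nu f : (forall x, 0 < nu x) -> 0 <= norm2sq nu f.
Proof. by move=> nu0; apply: sumr_ge0 => x _; rewrite mulr_ge0 ?sqr_ge0// ltW. Qed.

Lemma entL_ge0 nu f : (forall x, 0 < nu x) -> \sum_x nu x = 1 -> 0 <= entL nu f.
Proof.
move=> nu0 nu1; have := norm2sq_ge0 f nu0.
rewrite le_eqVlt => /predU1P[N0|N0]; last first.
  rewrite entLE//; apply: avg_ge0 => x; first exact: ltW.
  by rewrite ent_gap_ge0// sqr_ge0.
(* When the norm is 0, [f] vanishes everywhere, so the summands are 0 whatever the value of the
   logarithm. *)
apply: sumr_ge0 => x _; suff -> : f x ^+ 2 = 0 by rewrite !mul0r.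
move/esym/eqP: N0; rewrite psumr_eq0 => [/allP /(_ x)|y _]; last first.
  by rewrite mulr_ge0 ?sqr_ge0// ltW.
rewrite mem_index_enum => /(_ isT) /=.
by rewrite mulf_eq0 [nu x == 0]gt_eqF// orbF => /eqP.
Qed.

Lemma entL_const nu f : \sum_x nu x = 1 -> ~ nonconstant f -> entL nu f = 0.
Proof.
move=> nu1 fc; have E x y : f x = f y.
  by apply/eqP; apply/negPn/negP => xy; apply: fc; exists x, y.
apply: big1 => x _.
have -> : norm2sq nu f = f x ^+ 2.
  rewrite -[RHS]mulr1 -nu1 mulr_sumr; apply: eq_bigr => y _.
  by rewrite (E y x).
have [->|fx] := eqVneq (f x ^+ 2) 0; first by rewrite !mul0r.
by rewrite divff// ln1 mulr0 mul0r.
Qed.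

Lemma logsob_ge0 K pi : markov K -> (forall x, 0 < pi x) -> \sum_x pi x = 1 ->
  0 <= logsob (kstar_k K pi) pi.
Proof.
move=> mK pi0 pi1; rewrite /logsob; set S := (X in inf X).
(* With no admissible [f], for instance on one point, [logsob] is the infimum of the empty set,
   which is 0 by convention. *)
have [->|/set0P S0] := eqVneq S set0; first by rewrite inf0.
apply: lb_le_inf => // _ [f _ <-].
by rewrite divr_ge0 ?dirichlet_ge0 ?entL_ge0.
Qed.

Lemma logsob_le K pi f : markov K -> (forall x, 0 < pi x) -> \sum_x pi x = 1 ->
  logsob (kstar_k K pi) pi * entL pi f <= dirichlet (kstar_k K pi) pi f.
Proof.
move=> mK pi0 pi1; have [E0|E0] := eqVneq (entL pi f) 0.
  by rewrite E0 mulr0 dirichlet_ge0.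
have E1 : 0 < entL pi f by rewrite lt0r E0 entL_ge0.
rewrite -ler_pdivlMr//; apply: ge_inf.
  by exists 0 => _ [h _ <-]; rewrite divr_ge0 ?dirichlet_ge0 ?entL_ge0.
exists f => //; split => //.
by apply: contrapT => fc; move: E0; rewrite entL_const// eqxx.
Qed.

(** Holley-Stroock argument: the entropy under [nu] is at most the average of [ent_gap a] for any
    [a]. With [a] optimal for [pi], nonnegativity of the integrand lets [nu] be replaced by
    [C * pi]. *)
Lemma entL_compare nu pi C f : (forall x, 0 < f x) ->
  (forall x, 0 <= nu x) -> \sum_x nu x = 1 ->
  (forall x, 0 <= pi x) -> \sum_x pi x = 1 ->
  (forall x, nu x <= C * pi x) ->
  entL nu f <= C * entL pi f.
Proof.
move=> f0 nu0 nu1 pi0 pi1 nuC.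
have N2 mu : norm2sq mu f = avg mu (fun x => f x ^+ 2).
  by apply: eq_bigr => x _; rewrite mulrC.
have N0 mu : (forall x, 0 <= mu x) -> \sum_x mu x = 1 -> 0 < norm2sq mu f.
  by move=> mu0 mu1; rewrite N2; apply: avg_gt0 => // x; rewrite exprn_gt0.
set a := norm2sq pi f; have a0 : 0 < a by exact: N0.
set b := norm2sq nu f; have b0 : 0 < b by exact: N0.
apply: (@le_trans _ _ (avg nu (fun x => ent_gap a (f x ^+ 2)))).
  (* Using [a] in place of the optimal [b] costs exactly [ent_gap a b]. *)
  have -> : avg nu (fun x => ent_gap a (f x ^+ 2)) = entL nu f + ent_gap a b.
    have lnE x : f x ^+ 2 * ln (f x ^+ 2 / a) =
        f x ^+ 2 * ln (f x ^+ 2 / b) + ln (b / a) * f x ^+ 2.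
      have f2 : 0 < f x ^+ 2 by rewrite exprn_gt0.
      by rewrite !ln_div ?posrE//; ring.
    rewrite /ent_gap avgD avgB avg_cst nu1 (eq_avg _ lnE) avgD avgZ -N2 -/b.
    have -> : avg nu (fun x => f x ^+ 2 * ln (f x ^+ 2 / b)) = entL nu f.
      by apply: eq_bigr => x _; rewrite mulrC.
    by ring.
  by rewrite lerDl ent_gap_ge0// ltW.
rewrite entLE// -/a.
apply: (@le_trans _ _ (avg (fun x => C * pi x) (fun x => ent_gap a (f x ^+ 2)))).
  by apply: ler_avgl => // x; rewrite ent_gap_ge0// sqr_ge0.
by rewrite /avg mulr_sumr; under eq_bigr do rewrite -mulrA.
Qed.

(** One factor [C] is lost on the entropy ([push mu K] against [pi]), the other on the Dirichlet
    form ([pi] against [mu]). *)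
Lemma logsob_transfer K pi mu C f : markov K -> 0 < C -> (forall x, 0 < f x) ->
  (forall x, 0 < pi x) -> \sum_x pi x = 1 ->
  (forall x, 0 <= mu x) -> \sum_x mu x = 1 ->
  (forall x, pi x <= C * mu x) -> (forall x, push mu K x <= C * pi x) ->
  C ^- 2 * logsob (kstar_k K pi) pi * entL (push mu K) f <= avg mu (lvar K f).
Proof.
move=> mK C0 f0 pi0 pi1 mu0 mu1 piC muC.
have l0 := logsob_ge0 mK pi0 pi1.
have pi0' x : 0 <= pi x by exact: ltW.
have push0 x : 0 <= push mu K x.
  by apply: avg_ge0 => // y; case: mK.
have push1 : \sum_x push mu K x = 1 by rewrite sum_push.
have h1 := entL_compare f0 push0 push1 pi0' pi1 muC.
have h2 := logsob_le f mK pi0 pi1.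
have h3 := dirichlet_compare f mK pi0 piC.
rewrite -mulrA ler_pdivrMl ?exprn_gt0//.
have h4 := ler_wpM2l l0 h1.
have h5 := ler_wpM2l (ltW C0) (le_trans h2 h3).
by apply: (le_trans h4); rewrite expr2 -mulrA mulrCA.
Qed.

End Entropy.

(** * Hypercontractivity *)

Section Hypercontractivity.
Variables (R : realType) (V : finType).
Implicit Types (K L : kernel R V) (nu mu pi f g : V -> R).

Lemma bernoulli_powR (s p : R) : 0 < s -> 1 <= p -> 1 + p * (s - 1) <= s `^ p.
Proof.
move=> s0 p1; have sE : s = expR (ln s) by rewrite lnK.
rewrite /powR gt_eqF//; set u := ln s in sE *.
(* tangent of [expR] at [u], evaluated at [p * u] and at [0] *)
have tangent x : s * (1 + (x - u)) <= expR x.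
  have -> : expR x = s * expR (x - u) by rewrite {1}sE -expRD addrC subrK.
  by rewrite ler_pM2l// expR_ge1Dx.
have := tangent (p * u); have := tangent 0; rewrite expR0.
set E := expR _ => h0 h1.
(* This product is exactly the gap between the tangent value at [p * u] and the claimed lower bound;
   its sign is the tangent inequality at 0. *)
have h2 : 0 <= (p - 1) * (1 - s * (1 + (0 - u))).
  by rewrite mulr_ge0// subr_ge0.
lra.
Qed.

(** Jensen for powers: average Bernoulli's inequality at [s = f y / a]; the linear term drops out
    because [f / a] has mean 1. *)
Lemma act_powR_le K f p z : markov K -> (forall x, 0 < f x) -> 1 <= p ->
  act K f z `^ p <= act K (fun y => f y `^ p) z.
Proof.
move=> mK f0 p1; set a := act K f z; have a0 : 0 < a by exact: act_gt0.
have -> : a `^ p = act K (fun y => a `^ p * (1 + p * (f y / a - 1))) z.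
  rewrite /act avgZ avgD avgZ avgB -!/(act K _ z) !act_cst//.
  rewrite (_ : act K (fun x => f x / a) z = 1) ?subrr ?mulr0 ?addr0 ?mulr1//.
  rewrite /act (eq_avg _ (g := fun x => a^-1 * f x)) => [|x]; last exact: mulrC.
  by rewrite avgZ mulVf// gt_eqF.
apply: ler_act => // y.
have -> : f y `^ p = a `^ p * (f y / a) `^ p.
  by rewrite -powRM ?divr_ge0 ?ltW// mulrC divfK// gt_eqF.
by rewrite ler_pM2l ?powR_gt0// bernoulli_powR// divr_gt0.
Qed.

Lemma avg_ln_le nu g : (forall x, 0 <= nu x) -> \sum_x nu x = 1 ->
  (forall x, 0 < g x) -> avg nu (fun x => ln (g x)) <= ln (avg nu g).
Proof.
move=> nu0 nu1 g0; set G := avg nu g; have G0 : 0 < G by exact: avg_gt0.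
rewrite -[ln G]mulr1 -nu1 -avg_cst -subr_le0 -avgB.
have -> : 0 = avg nu (fun x => G^-1 * g x - 1).
  by rewrite avgB avgZ avg_cst nu1 mulVf ?gt_eqF// mulr1 subrr.
apply: ler_avg => // x; rewrite -ln_div ?posrE// [G^-1 * _]mulrC.
by rewrite ln_le_sub1// divr_gt0.
Qed.

(* Writing [S = avg (f^p)], [T = avg (f^q)] under [push mu K], the log-Sobolev
   inequality for [f^(p/2)] gives
   [avg ((Kf)^p) <= S - l Ent(f^p) <= S exp (- l Ent(f^p) / S)], and Jensen for the density [f^p / S] bounds [Ent(f^p) / S] from below by
   the growth of the norm of [f] between the exponents [q] and [p]. *)
Lemma hypercontractive_step K mu l q f : markov K ->
  (forall x, 0 <= mu x) -> \sum_x mu x = 1 -> 0 <= l -> 2 <= q ->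
  (forall g, (forall x, 0 < g x) -> l * entL (push mu K) g <= avg mu (lvar K g)) ->
  (forall x, 0 < f x) ->
  avg mu (fun z => act K f z `^ (q * (1 + l)))
    <= avg (push mu K) (fun y => f y `^ q) `^ (1 + l).
Proof.
move=> mK mu0 mu1 l0 q2 LS f0; set nu := push mu K; set p := q * (1 + l).
have p2 : 2 <= p by rewrite /p; nra.
have nu0 x : 0 <= nu x by apply: avg_ge0 => // y; case: mK.
have nu1 : \sum_x nu x = 1 by rewrite sum_push.
set S := avg nu (fun y => f y `^ p); set T := avg nu (fun y => f y `^ q).
have S0 : 0 < S by apply: avg_gt0 => // x; exact: powR_gt0.
have T0 : 0 < T by apply: avg_gt0 => // x; exact: powR_gt0.
pose g y := f y `^ (p / 2).
have g0 y : 0 < g y by exact: powR_gt0.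
have powp (a : R) : a `^ p = (a `^ (p / 2)) ^+ 2.
  by rewrite -powR_mulrn ?powR_ge0// -powRrM divfK ?pnatr_eq0.
(* Jensen is used with exponent [p / 2], which is at least 1 since [q], hence [p], is at least 2. *)
have S_lvar : avg mu (fun z => act K f z `^ p) <= S - avg mu (lvar K g).
  rewrite avg_lvar /S (eq_avg _ (fun y => powp (f y))) subKr.
  apply: ler_avg => // z; rewrite powp ler_sqr ?nnegrE ?powR_ge0//.
    by apply: act_powR_le => //; lra.
  by rewrite ltW// act_gt0.
have NS : norm2sq nu g = S.
  by apply: eq_bigr => y _; rewrite powp mulrC.
set w := fun x => nu x * f x `^ p / S.
have w0 x : 0 <= w x by rewrite /w divr_ge0 ?mulr_ge0 ?powR_ge0// ltW.
have w1 : \sum_x w x = 1 by rewrite -mulr_suml divff// gt_eqF.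
set M := avg w (fun x => ln (f x)).
have entE : entL nu g = S * (p * M - ln S).
  have -> : p * M - ln S = avg w (fun x => p * ln (f x) - ln S).
    by rewrite avgB avgZ avg_cst w1 mulr1.
  rewrite /avg mulr_sumr.
  apply: eq_bigr => x _; rewrite /w NS -powp ln_div ?posrE ?powR_gt0// ln_powR.
  by field; rewrite gt_eqF.
have lnT : ln S - (p - q) * M <= ln T.
  have -> : T = S * avg w (fun x => f x `^ (q - p)).
    rewrite /avg mulr_sumr; apply: eq_bigr => x _; rewrite /w.
    rewrite powRB ?(gt_eqF (f0 x)) ?implybT//.
    by field; rewrite !gt_eqF// powR_gt0.
  rewrite lnM ?posrE//; last by apply: avg_gt0 => // x; exact: powR_gt0.
  rewrite lerD2l; apply: le_trans (avg_ln_le _ _ _) => // [|x]; last exact: powR_gt0.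
  under eq_avg do rewrite ln_powR.
  by rewrite avgZ -mulNr opprB.
apply: (le_trans S_lvar).
apply: (@le_trans _ _ (S * expR (- (l * (p * M - ln S))))).
  apply: (@le_trans _ _ (S * (1 + - (l * (p * M - ln S))))).
    have := LS g g0; rewrite -/nu entE; nra.
  by rewrite ler_pM2l// expR_ge1Dx.
rewrite -{1}(lnK S0) -expRD /powR gt_eqF// ler_expR.
(* Since [p - q = q * l], one has [(1 + l) * (p - q) = l * p], so [1 + l] times [lnT] is the
   required comparison of exponents. *)
have l1 : 0 <= 1 + l by lra.
have := ler_wpM2l l1 lnT; rewrite /p; nra.
Qed.

Variables (mu : V -> R) (K : nat -> kernel R V) (l : nat -> R).
Hypothesis mK : forall i, (0 < i)%N -> markov (K i).
Hypothesis mu_ge0 : forall x, 0 <= mu x.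
Hypothesis mu1 : \sum_x mu x = 1.
Hypothesis l_ge0 : forall i, (0 < i)%N -> 0 <= l i.
Hypothesis LS : forall i g, (forall x, 0 < g x) ->
  l i.+1 * entL (mun mu K i.+1) g <= avg (mun mu K i) (lvar (K i.+1) g).

Lemma prod_ge1 n : 1 <= \prod_(1 <= i < n.+1) (1 + l i).
Proof.
rewrite big_nat_cond; apply: (big_ind (fun a => 1 <= a)) => // [a b a1 b1|i].
  by rewrite mulr_ege1.
by case/andP => /andP[i0 _] _; rewrite lerDl l_ge0.
Qed.

(** The last kernel is peeled off: it raises the exponent from [q] to [q * (1 + l n.+1)], and the
    induction hypothesis is used at this new exponent for [act (K n.+1) f]. Hence [q] and [f] vary
    in the induction. *)
Lemma hypercontractive n q f : 2 <= q -> (forall x, 0 < f x) ->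
  let r := \prod_(1 <= i < n.+1) (1 + l i) in
  avg mu (fun z => act (Kprod K n) f z `^ (q * r))
    <= avg (mun mu K n) (fun y => f y `^ q) `^ r.
Proof.
move=> q2 f0 /=; elim: n q f q2 f0 => [|n IH] q f q2 f0.
  rewrite big_geq// mulr1 powRr1; last first.
    by apply: avg_ge0 => x; rewrite ?mun0// powR_ge0.
  by rewrite (eq_avgl _ (mun0 _ _)); under eq_avg do rewrite act_kid.
rewrite big_nat_recr//=; set r := \prod_(_ <= _ < _) _.
have r1 : 1 <= r by exact: prod_ge1.
have l0 : 0 <= l n.+1 by exact: l_ge0.
have mKn : markov (K n.+1) by exact: mK.
have mun_ge0 x : 0 <= mun mu K n x.
  by apply: avg_ge0 => // y; have [] := markov_Kprod n mK.
have Kf0 x : 0 < act (K n.+1) f x by exact: act_gt0.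
rewrite [r * _]mulrC mulrA.
under eq_avg do rewrite act_kmul.
have q2' : 2 <= q * (1 + l n.+1).
  by rewrite (le_trans q2)// ler_peMr ?lerDl//; lra.
apply: le_trans (IH _ _ q2' Kf0) _.
rewrite powRrM; apply: ge0_ler_powR; rewrite ?nnegrE ?powR_ge0//.
- exact: le_trans r1.
- by apply: avg_ge0 => // x; exact: powR_ge0.
rewrite (eq_avgl _ (munS _ _ _)); apply: hypercontractive_step => //.
- exact: mun_sum1.
move=> g g0; apply: le_trans (LS n g0).
rewrite le_eqVlt; apply/orP; left; apply/eqP; congr (_ * _).
by congr entL; apply/funext => y; rewrite munS.
Qed.

(** Hypercontractivity from [q = 2], keeping only the atom [x] on the left, gives
    [mu x * a ^ (2 r) <= A ^ r]. The condition on [r] says precisely that [mu x ^ (- 1 / r)] is at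
    most [expR 2]. *)
Lemma act_Kprod_le n f x : 0 < mu x -> (forall y, 0 < f y) ->
  ln (Num.sqrt (mu x))^-1 <= \prod_(1 <= i < n.+1) (1 + l i) ->
  act (Kprod K n) f x ^+ 2 <= expR 2 * avg (mun mu K n) (fun y => f y ^+ 2).
Proof.
move=> mux f0; set r := \prod_(_ <= _ < _) _ => lnr.
have r1 : 1 <= r by exact: prod_ge1.
have := @hypercontractive n 2 f (lexx 2) f0; rewrite -/r /=.
set A := avg (mun _ _ _) _ => H.
have -> : avg (mun mu K n) (fun y => f y ^+ 2) = A.
  by apply: eq_avg => y; rewrite powR_mulrn// ltW.
set a := act (Kprod K n) f x.
have a0 : 0 < a by apply: act_gt0 => //; exact: markov_Kprod.
have mun_ge0 y : 0 <= mun mu K n y.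
  by apply: avg_ge0 => // z; have [] := markov_Kprod n mK.
have A0 : 0 < A.
  by apply: avg_gt0 => // [|y]; [exact: mun_sum1|exact: powR_gt0].
have {}H : mu x * a `^ (2 * r) <= A `^ r.
  apply: le_trans H; rewrite [leRHS](bigD1 x)//= lerDl sumr_ge0// => y _.
  by rewrite mulr_ge0// powR_ge0.
have lnsqrt : ln (Num.sqrt (mu x))^-1 = - 2^-1 * ln (mu x).
  rewrite lnV ?posrE ?sqrtr_gt0// -powR12_sqrt; last exact: ltW.
  by rewrite ln_powR mulNr.
have lnH : ln (mu x) + 2 * r * ln a <= r * ln A.
  have := H; rewrite -ler_ln ?posrE ?mulr_gt0 ?powR_gt0//.
  by rewrite lnM ?posrE ?powR_gt0// !ln_powR.
rewrite -ler_ln ?posrE ?mulr_gt0 ?expR_gt0 ?exprn_gt0//.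
rewrite lnXn// lnM ?posrE ?expR_gt0// expRK -mulr_natl.
rewrite -(ler_pM2l (lt_le_trans ltr01 r1)).
by move: lnr; rewrite lnsqrt; lra.
Qed.

End Hypercontractivity.

(** * Spectral gap *)

Section SpectralGap.
Variables (R : realType) (V : finType).
Implicit Types (K L : kernel R V) (nu mu pi f g : V -> R).

Definition var nu f : R := avg nu (fun x => f x ^+ 2) - avg nu f ^+ 2.

Lemma avg_sqrB nu f a : \sum_x nu x = 1 ->
  avg nu (fun x => (f x - a) ^+ 2) = var nu f + (avg nu f - a) ^+ 2.
Proof.
move=> nu1; rewrite (eq_avg _ (g := fun x => a ^+ 2 + (- 2 * a) * f x + f x ^+ 2)).
  by rewrite !avgD avg_cst avgZ nu1 /var; ring.
by move=> x; ring.
Qed.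

(** The variance is the least second moment about a point; centering both sides at the [pi]-mean
    leaves a nonnegative integrand to compare. *)
Lemma var_compare nu pi C f : (forall x, 0 <= pi x) ->
  \sum_x nu x = 1 -> \sum_x pi x = 1 ->
  (forall x, nu x <= C * pi x) -> var nu f <= C * var pi f.
Proof.
move=> pi0 nu1 pi1 nuC; have := avg_sqrB f (avg pi f) nu1.
have := avg_sqrB f (avg pi f) pi1; rewrite subrr expr0n addr0 => <- nuE.
apply: (@le_trans _ _ (avg nu (fun x => (f x - avg pi f) ^+ 2))).
  by rewrite nuE lerDl sqr_ge0.
apply: (@le_trans _ _ (avg (fun x => C * pi x) (fun x => (f x - avg pi f) ^+ 2))).
  by apply: ler_avgl => // x; exact: sqr_ge0.
by rewrite /avg mulr_sumr; under eq_bigr do rewrite -mulrA.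
Qed.

Lemma kstar_adjoint K pi f g : (forall x, 0 < pi x) ->
  avg pi (fun v => f v * act (kstar_k K pi) g v) =
  avg pi (fun z => act K f z * act K g z).
Proof.
move=> pi0; rewrite /avg.
have -> : \sum_v pi v * (f v * act (kstar_k K pi) g v) =
    \sum_v \sum_w \sum_z pi z * (K z v * f v * (K z w * g w)).
  apply: eq_bigr => v _; rewrite /act /avg !mulr_sumr; apply: eq_bigr => w _.
  transitivity ((\sum_z pi z * K z v * K z w) * (f v * g w)).
    by rewrite /kstar_k; field; rewrite gt_eqF.
  by rewrite mulr_suml; apply: eq_bigr => z _; ring.
under eq_bigr do rewrite exchange_big /=.
rewrite exchange_big /=; apply: eq_bigr => z _.
rewrite /act /avg mulr_suml mulr_sumr; apply: eq_bigr => v _.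
by rewrite !mulr_sumr.
Qed.

Section Eigenbasis.
Variables (pi : V -> R) (e : nat -> V -> R).
Hypothesis ortho : forall i j, (i < #|V|)%N -> (j < #|V|)%N ->
  \sum_v e i v * e j v * pi v = (i == j)%:R.

(** Orthonormality reads [A *m B = 1] for square matrices; completeness is the reversed product
    [B *m A = 1]. *)
Lemma eigenbasis_complete v w : \sum_(j < #|V|) e j v * (e j w * pi w) = (v == w)%:R.
Proof.
pose A : 'M[R]_#|V| := \matrix_(i, j) e i (enum_val j).
pose B : 'M[R]_#|V| := \matrix_(i, j) (e j (enum_val i) * pi (enum_val i)).
have AB : A *m B = 1%:M.
  apply/matrixP => i j; rewrite !mxE -[RHS](ortho (ltn_ord i) (ltn_ord j)).
  under [RHS]eq_bigr do rewrite -mulrA.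
  rewrite [RHS](_ : _ = \sum_(x in V) e i x * (e j x * pi x))// [RHS]big_enum_val.
  by apply: eq_bigr => k _; rewrite !mxE.
have /matrixP/(_ (enum_rank w) (enum_rank v)) := mulmx1C AB.
rewrite !mxE (inj_eq enum_rank_inj) eq_sym => <-; apply: eq_bigr => j _.
by rewrite !mxE !enum_rankK mulrC.
Qed.

Lemma parseval f g :
  avg pi (fun v => f v * g v) =
  \sum_(j < #|V|) avg pi (fun v => e j v * f v) * avg pi (fun v => e j v * g v).
Proof.
have -> : avg pi (fun v => f v * g v) =
    \sum_v \sum_w \sum_(j < #|V|) (pi v * (e j v * f v)) * (pi w * (e j w * g w)).
  apply: eq_bigr => v _.
  transitivity (\sum_w pi v * f v * g w * (v == w)%:R).
    rewrite (bigD1 v)//= eqxx mulr1 big1 ?addr0 ?mulrA// => w.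
    by rewrite eq_sym => /negPf ->; rewrite mulr0.
  apply: eq_bigr => w _; rewrite -eigenbasis_complete mulr_sumr.
  by apply: eq_bigr => j _; ring.
under eq_bigr do rewrite exchange_big /=.
rewrite exchange_big /=; apply: eq_bigr => j _.
by rewrite /avg mulr_suml; apply: eq_bigr => v _; rewrite mulr_sumr.
Qed.

End Eigenbasis.

(** In the eigenbasis, with coefficients [a j], the Dirichlet form is the sum of
    [(1 - lam j) * a j ^+ 2]. When [lam 1 < 1] the variance is the sum of [a j ^+ 2] over [j > 0];
    when [lam 1 = 1] the left side is 0. *)
Lemma second_sv_gap K pi s f : markov K -> (forall x, 0 < pi x) ->
  invariant_prob K pi -> second_sv K pi s ->
  s ^+ 2 <= 1 /\ (1 - s ^+ 2) * var pi f <= dirichlet (kstar_k K pi) pi f.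
Proof.
move=> mK pi0 [_ [pi1 piK]] [e [lam [ortho [eigen [mono ->]]]]].
have dir0 := dirichlet_ge0 f mK pi0.
have piA h : avg pi (act K h) = avg pi h by rewrite -avg_push; exact: eq_avgl.
have piL h : avg pi (lvar K h) =
    avg pi (fun y => h y ^+ 2) - avg pi (fun z => act K h z * act K h z).
  by rewrite avg_lvar (eq_avgl _ piK).
have Pe j h : (j < #|V|)%N ->
    avg pi (fun z => act K h z * act K (e j) z) = lam j * avg pi (fun v => e j v * h v).
  move=> jV; rewrite -kstar_adjoint// -avgZ; apply: eq_avg => v.
  by rewrite [act _ _ v](eigen j jV); ring.
have ejj j : (j < #|V|)%N -> avg pi (fun v => e j v * e j v) = 1.
  move=> jV; have := ortho j j jV jV; rewrite eqxx => ojj; rewrite -[RHS]ojj.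
  by apply: eq_bigr => v _; rewrite mulrC.
have lam0 j : (j < #|V|)%N -> 0 <= lam j.
  move=> jV; rewrite -[lam j]mulr1 -(ejj j jV) -Pe//.
  by apply: avg_ge0 => x; [exact: ltW|rewrite -expr2 sqr_ge0].
have lam1 j : (j < #|V|)%N -> lam j <= 1.
  move=> jV; rewrite -subr_ge0 -[lam j]mulr1 -(ejj j jV) -Pe//.
  rewrite -[X in X - _](_ : avg pi (fun y => e j y ^+ 2) = _); last exact: eq_avg.
  by rewrite -piL; apply: avg_ge0 => x; [exact: ltW|exact: lvar_ge0].
(* On a single point [s] is 0 by convention, and the variance vanishes. *)
have [V1|V1] := ltnP 1 #|V|; last first.
  rewrite expr0n subr0 mul1r; split => //; suff -> : var pi f = 0 by [].
  have fE x y : f x = f y by move: V1 => /card_le1_eqP/(_ x y isT isT) ->.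
  have [y _|V0] := pickP (xpredT : pred V); last first.
    by move: pi1; rewrite big_pred0// => /esym/eqP; rewrite oner_eq0.
  rewrite /var (eq_avg _ (g := fun=> f y ^+ 2)); last by move=> z; rewrite (fE z y).
  rewrite (eq_avg _ (g := fun=> f y) (f := f)); last by move=> z; exact: fE.
  by rewrite !avg_cst pi1 !mulr1 subrr.
have V0 : (0 < #|V|)%N by exact: ltnW.
rewrite sqr_sqrtr ?lam0//; split; first exact: lam1.
have := lam1 1%N V1; rewrite le_eqVlt => /predU1P[->|l1].
  by rewrite subrr mul0r.
(* Pairing [e j] with the constant 1 gives [avg pi (e j) = lam j * avg pi (e j)], where
   [lam j <= lam 1 < 1]. *)
have b0 j : (j < #|V|)%N -> (0 < j)%N -> avg pi (e j) = 0.
  move=> jV j0; have := Pe j (fun=> 1) jV.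
  rewrite (eq_avg _ (g := act K (e j))); last by move=> z; rewrite act_cst// mul1r.
  rewrite piA (eq_avg _ (g := e j)); last by move=> z; rewrite mulr1.
  have : lam j < 1 by exact: le_lt_trans (mono 1%N j _ _) l1.
  by move=> lj /eqP; rewrite -subr_eq0 -{1}[avg _ _]mul1r -mulrBl mulf_eq0
    subr_eq0 gt_eqF// => /eqP.
pose a (j : nat) := avg pi (fun v => e j v * f v).
have avgf2 : avg pi (fun x => f x ^+ 2) = \sum_(j < #|V|) a j ^+ 2.
  exact: (parseval ortho f f).
pose i0 := Ordinal V0.
have e1 j : avg pi (fun v => e j v * 1) = avg pi (e j).
  by apply: eq_avg => v; rewrite mulr1.
have avgf : avg pi f ^+ 2 = a 0%N ^+ 2.
  have f1 : avg pi f = a 0%N * avg pi (e 0%N).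
    rewrite (eq_avg _ (g := fun v => f v * 1)); last by move=> v; rewrite mulr1.
    rewrite (parseval ortho f (fun=> 1)) (bigD1 i0)//= big1 ?addr0 ?e1// => j ji0.
    by rewrite e1 b0 ?mulr0// lt0n.
  have b01 : avg pi (e 0%N) ^+ 2 = 1.
    have := parseval ortho (fun=> 1) (fun=> 1); rewrite mulr1 avg_cst pi1 mul1r.
    rewrite (bigD1 i0)//= big1 ?addr0 ?e1// => j ji0.
    by rewrite e1 b0 ?mulr0// lt0n.
  by rewrite f1 exprMn b01 mulr1.
have dirf : dirichlet (kstar_k K pi) pi f = \sum_(j < #|V|) (1 - lam j) * a j ^+ 2.
  rewrite dirichletE// piL avgf2 -kstar_adjoint// (parseval ortho) -sumrB.
  apply: eq_bigr => j _; rewrite mulrBl mul1r; congr (_ - _).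
  rewrite kstar_adjoint// expr2 mulrCA -(Pe j f)//; congr (_ * _).
  by apply: eq_avg => v; rewrite mulrC.
rewrite dirf /var avgf avgf2 (bigD1 i0)//= addrC addrK mulr_sumr.
rewrite [leRHS](bigD1 i0)//= -[leLHS]add0r lerD//.
  by rewrite mulr_ge0 ?sqr_ge0// subr_ge0 lam1.
apply: ler_sum => j ji0; rewrite ler_wpM2r ?sqr_ge0// lerD2l lerN2 mono//.
by rewrite lt0n.
Qed.

(* the adjoint of [K : l^2(push mu K) -> l^2(mu)] *)
Definition dual mu K h : V -> R := fun y => (push mu K y)^-1 * \sum_z mu z * K z y * h z.

Lemma dualE mu K h f : (forall y, 0 < push mu K y) ->
  avg (push mu K) (fun y => dual mu K h y * f y) = avg mu (fun z => h z * act K f z).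
Proof.
move=> mu'0; transitivity (\sum_y \sum_z mu z * K z y * h z * f y).
  apply: eq_bigr => y _; rewrite /dual !mulrA divff ?gt_eqF// mul1r.
  by rewrite mulr_suml.
rewrite exchange_big; apply: eq_bigr => z _; rewrite /act /avg !mulr_sumr.
by apply: eq_bigr => y _; ring.
Qed.

(** The gap bounds the norm of [K g] for [g = dual mu K h]: its square is at most [rho * A]. As [A]
    is also the pairing of [h] with [K g], expanding the square of [rho * h - K g] yields
    [rho * A <= rho ^+ 2 * H]. *)
Lemma dual_contraction mu K pi C s h : markov K -> 1 < C ->
  (forall x, 0 <= mu x) -> \sum_x mu x = 1 -> (forall y, 0 < push mu K y) ->
  (forall x, 0 < pi x) -> invariant_prob K pi -> second_sv K pi s ->
  (forall x, pi x <= C * mu x) -> (forall x, push mu K x <= C * pi x) ->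
  avg mu h = 0 ->
  avg (push mu K) (fun y => dual mu K h y ^+ 2)
    <= (1 - C ^- 2 * (1 - s ^+ 2)) * avg mu (fun z => h z ^+ 2).
Proof.
move=> mK C1 mu0 mu1 mu'0 pi0 piK sv piC muC h0.
set g := dual mu K h; set rho := (1 - C ^- 2 * (1 - s ^+ 2)).
have C0 : 0 < C by exact: lt_trans C1.
have pi1 : \sum_x pi x = 1 by case: piK => _ [].
have [s1 gap] := second_sv_gap g mK pi0 piK sv.
have s0 : 0 <= 1 - s ^+ 2 by rewrite subr_ge0.
(* Strict positivity comes from [1 < C] and permits the final division by [rho]. *)
have rho0 : 0 < rho.
  rewrite subr_gt0 ltr_pdivrMl ?exprn_gt0// mulr1.
  rewrite (@le_lt_trans _ _ 1)//; first by rewrite gerBl sqr_ge0.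
  by rewrite exprn_egt1.
have g0 : avg (push mu K) g = 0.
  have := dualE h (fun=> 1) mu'0.
  rewrite (eq_avg _ (g := g)) => [->|y]; last exact: mulr1.
  by rewrite (eq_avg _ (g := h)) => // z; rewrite act_cst// mulr1.
set A := avg _ _; set H := avg mu _.
have AE : A = avg mu (fun z => h z * act K g z) by rewrite -dualE.
have Kg : avg mu (fun z => act K g z ^+ 2) <= rho * A.
  have varA : var (push mu K) g = A by rewrite /var g0 expr0n subr0.
  have h1 : A <= C * var pi g.
    rewrite -varA; apply: var_compare => // [x|]; first exact: ltW.
    by rewrite sum_push.
  have h2 := dirichlet_compare g mK pi0 piC.
  have h3 : C ^- 2 * (1 - s ^+ 2) * A <= avg mu (lvar K g).
    rewrite -mulrA ler_pdivrMl ?exprn_gt0// expr2 -mulrA.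
    apply: (le_trans (ler_wpM2l s0 h1)); rewrite mulrCA ler_pM2l//.
    exact: le_trans h2.
  by move: h3; rewrite avg_lvar -/A /rho; lra.
have : 0 <= avg mu (fun z => (rho * h z - act K g z) ^+ 2).
  by apply: avg_ge0 => // z; exact: sqr_ge0.
rewrite (eq_avg _ (g := fun z => rho ^+ 2 * h z ^+ 2 + (- 2 * rho) * (h z * act K g z)
   + act K g z ^+ 2)); last by move=> z; ring.
rewrite !avgD !avgZ -AE -/H => sq; rewrite -(ler_pM2l rho0).
by move: sq Kg; lra.
Qed.

End SpectralGap.

(** * Densities of the chain *)

Section Merging.
Variables (R : realType) (V : finType) (mu0 : V -> R) (K : nat -> kernel R V).
Hypothesis mK : forall i, (0 < i)%N -> markov (K i).
Hypothesis mu1 : \sum_x mu0 x = 1.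
Hypothesis mun_gt0 : forall n x, 0 < mun mu0 K n x.
Variable x : V.

Definition density n y := Kprod K n x y / mun mu0 K n y.

Lemma avg_density n f :
  avg (mun mu0 K n) (fun y => density n y * f y) = act (Kprod K n) f x.
Proof.
by apply: eq_bigr => y _; rewrite /density mulrA mulrCA divff ?mulr1// gt_eqF.
Qed.

Lemma avg_density1 n : avg (mun mu0 K n) (density n) = 1.
Proof.
rewrite -[RHS](act_cst 1 x (markov_Kprod n mK)) -avg_density.
by apply: eq_avg => y; rewrite mulr1.
Qed.

Lemma d2E n : d2 (Kprod K n x) (mun mu0 K n) ^+ 2 =
  avg (mun mu0 K n) (fun y => (density n y - 1) ^+ 2).
Proof.
rewrite /d2 sqr_sqrtr.
  by apply: eq_bigr => y _; rewrite real_normK ?num_real// mulrC.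
by apply: sumr_ge0 => y _; rewrite mulr_ge0 ?sqr_ge0// ltW.
Qed.

(** Duality: [act (Kprod K m) f x] is the pairing of [f] with the density, so testing on the density
    itself would give [A ^+ 2 <= E * A]. Only positive test functions are allowed, hence a
    perturbation. *)
Lemma density_norm_le m E : 1 <= E ->
  (forall f, (forall y, 0 < f y) ->
    act (Kprod K m) f x ^+ 2 <= E * avg (mun mu0 K m) (fun y => f y ^+ 2)) ->
  avg (mun mu0 K m) (fun y => density m y ^+ 2) <= E.
Proof.
move=> E1 hyp; set A := avg _ _; rewrite leNgt; apply/negP => EA.
have munm1 : \sum_y mun mu0 K m y = 1 by exact: mun_sum1.
have mKm := markov_Kprod m mK.
have A0 : 0 < A by apply: lt_trans EA; exact: lt_le_trans E1.
(* [density + eps] is positive; this [eps] is small enough to contradict [A > E] *)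
pose eps := (A - E) / A.
have eps0 : 0 < eps by rewrite divr_gt0// subr_gt0.
have epsA : eps * A = A - E by rewrite divfK// gt_eqF.
have u0 y : 0 < density m y + eps.
  by rewrite ltr_wpDl// divr_ge0//; [case: mKm|exact: ltW].
have := hyp _ u0.
have -> : act (Kprod K m) (fun y => density m y + eps) x = A + eps.
  rewrite /act avgD avg_cst -/(act _ _ x) -avg_density; congr (_ + _).
  by case: mKm => _ ->; rewrite mulr1.
have -> : avg (mun mu0 K m) (fun y => (density m y + eps) ^+ 2) = A + 2 * eps + eps ^+ 2.
  rewrite (eq_avg _ (g := fun y =>
    density m y ^+ 2 + (2 * eps) * density m y + eps ^+ 2)).
    by rewrite !avgD avgZ avg_cst avg_density1 munm1 !mulr1.
  by move=> y; ring.
apply/negP; rewrite -ltNge.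
have h1 : 0 < A * (A - E) by rewrite mulr_gt0// subr_gt0.
have h2 : 0 <= eps * eps * (A - (E - 1)).
  by rewrite mulr_ge0//; [rewrite mulr_ge0 ?ltW|lra].
have h3 : eps * (eps * A) = eps * (A - E) by rewrite epsA.
have h4 : 0 <= eps * (A - E) by rewrite mulr_ge0 ?ltW// subr_gt0.
lra.
Qed.

(** Densities evolve by the adjoint, which fixes the constant 1, so subtracting 1 is harmless. *)
Lemma density_step n :
  (fun y => density n.+1 y - 1) =1
  dual (mun mu0 K n) (K n.+1) (fun z => density n z - 1).
Proof.
move=> y; rewrite /dual.
have -> : \sum_z mun mu0 K n z * K n.+1 z y * (density n z - 1) =
    Kprod K n.+1 x y - mun mu0 K n.+1 y.
  rewrite munS /= /kmul /push -sumrB; apply: eq_bigr => z _; rewrite /density.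
  by field; rewrite gt_eqF.
by rewrite -munS mulrBr mulVf ?gt_eqF// mulrC.
Qed.

Lemma d2_step n pi C s : 1 < C -> (forall y, 0 < pi y) ->
  invariant_prob (K n.+1) pi -> second_sv (K n.+1) pi s ->
  (forall y, pi y <= C * mun mu0 K n y) -> (forall y, mun mu0 K n.+1 y <= C * pi y) ->
  d2 (Kprod K n.+1 x) (mun mu0 K n.+1) ^+ 2
    <= (1 - C ^- 2 * (1 - s ^+ 2)) * d2 (Kprod K n x) (mun mu0 K n) ^+ 2.
Proof.
move=> C1 pi0 piK sv piC muC; rewrite !d2E (eq_avgl _ (munS _ _ _)).
rewrite (eq_avg _ (g := fun y =>
  dual (mun mu0 K n) (K n.+1) (fun z => density n z - 1) y ^+ 2)); last first.
  by move=> y; rewrite -density_step.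
apply: (dual_contraction (mK (ltn0Sn n)) C1 _ _ _ pi0 piK sv) => //.
- by move=> y; exact: ltW.
- exact: mun_sum1.
- by move=> y; rewrite -munS.
- by move=> y; rewrite -munS.
by rewrite avgB avg_density1 avg_cst mun_sum1// mul1r subrr.
Qed.

End Merging.

(** * The merging bound: entropy phase up to time [m], spectral decay afterwards *)

Theorem theorem4p7 (R : realType) (V : finType) (c : R)
  (Q : kernel R V -> Prop) (mu0 : V -> R) (K : nat -> kernel R V)
  (pi : nat -> V -> R) (sigma1 : nat -> R) (x : V) (m n : nat) :
  1 < c ->
  (forall P, Q P -> markov P /\ irreducible P /\ aperiodic P) ->
  pos_prob mu0 ->
  c_stable Q mu0 c ->
  (forall i, (1 <= i)%N -> Q (K i)) ->
  (forall i, (1 <= i)%N -> invariant_prob (K i) (pi i)) ->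
  (forall i, (1 <= i)%N -> second_sv (K i) (pi i) (sigma1 i)) ->
  is_mtilde c K pi mu0 x m ->
  (m <= n)%N ->
  d2 (Kprod K n x) (mun mu0 K n) ^+ 2
    <= expR 2 * \prod_(m.+1 <= i < n.+1) (1 - c ^- 4 * (1 - sigma1 i ^+ 2)).
Proof.
move=> c1 QP pmu stab QK piK sv [mm _] mn.
have [mu0_gt0 mu1] := pmu.
have c0 : 0 < c by exact: lt_trans c1.
have C1 : 1 < c ^+ 2 by rewrite exprn_egt1.
have C0 : 0 < c ^+ 2 by exact: lt_trans C1.
(* The comparison constant is [C = c ^+ 2], one [c] on each side of [mu0], so the loss [C ^- 2] is
   [c ^- 4]. *)
have cC : c ^- 4 = (c ^+ 2) ^- 2 by rewrite -exprM.
have mK i : (0 < i)%N -> markov (K i) by move=> /QK /QP [].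
have pib i : (0 < i)%N ->
    forall y, c^-1 * mu0 y <= pi i y /\ pi i y <= c * mu0 y.
  move=> i0; have [mKi [iK _]] := QP _ (QK _ i0).
  exact: stationary_bounds pmu stab (QK _ i0) mKi iK (piK _ i0).
have mub k y : c^-1 * mu0 y <= mun mu0 K k y /\ mun mu0 K k y <= c * mu0 y.
  by have /andP[] := stab K QK k y; rewrite ler_pdivlMr// ler_pdivrMr.
have mun_gt0 k y : 0 < mun mu0 K k y.
  by apply: lt_le_trans (mub k y).1; rewrite mulr_gt0 ?invr_gt0.
have pi_gt0 i : (0 < i)%N -> forall y, 0 < pi i y.
  by move=> i0 y; apply: lt_le_trans (pib i i0 y).1; rewrite mulr_gt0 ?invr_gt0.
have pi1 i : (0 < i)%N -> \sum_y pi i y = 1 by move=> /piK [_ []].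
have compare (a b u : R) : c^-1 * u <= a -> b <= c * u -> b <= c ^+ 2 * a.
  rewrite ler_pdivrMl// => ua /le_trans; apply.
  by rewrite expr2 -mulrA ler_pM2l.
have piC i k : (0 < i)%N -> forall y, pi i y <= c ^+ 2 * mun mu0 K k y.
  by move=> i0 y; exact: compare (mub k y).1 (pib i i0 y).2.
have muC i k : (0 < i)%N -> forall y, mun mu0 K k y <= c ^+ 2 * pi i y.
  by move=> i0 y; exact: compare (pib i i0 y).1 (mub k y).2.
pose l i := c ^- 4 * logsob (kstar_k (K i) (pi i)) (pi i).
have l_ge0 i : (0 < i)%N -> 0 <= l i.
  move=> i0; rewrite mulr_ge0//; first by rewrite invr_ge0 exprn_ge0// ltW.
  by apply: logsob_ge0; [exact: mK|exact: pi_gt0|exact: pi1].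
have LS i g : (forall y, 0 < g y) ->
    l i.+1 * entL (mun mu0 K i.+1) g <= avg (mun mu0 K i) (lvar (K i.+1) g).
  move=> g0; have -> : mun mu0 K i.+1 = push (mun mu0 K i) (K i.+1).
    by apply/funext => y; rewrite munS.
  rewrite /l cC; apply: logsob_transfer => //.
  - exact: mK.
  - exact: pi_gt0.
  - exact: pi1.
  - by move=> y; exact: ltW.
  - exact: mun_sum1.
  - exact: piC.
  - by move=> y; rewrite -munS; exact: muC.
have lnr : ln (Num.sqrt (mu0 x))^-1 <= \prod_(1 <= i < m.+1) (1 + l i).
  have r1 := prod_ge1 l_ge0 m.
  (* If the inner logarithm is not positive ([mu0 x = 1]), the outer one only has its default value,
     but the product is at least 1 anyway. Otherwise exponentiate the defining condition of [m]. *)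
  have [L0|L0] := lerP (ln (Num.sqrt (mu0 x))^-1) 0.
    by apply: (le_trans L0); exact: le_trans r1.
  have r0 : 0 < \prod_(1 <= i < m.+1) (1 + l i) by exact: lt_le_trans r1.
  rewrite -ler_ln ?posrE//; apply: (le_trans mm).
  rewrite /lsum; elim: (m) => [|k IH]; first by rewrite !big_geq// ln1.
  have rk := prod_ge1 l_ge0 k.
  rewrite (big_nat_recr k.+1)// [in leRHS](big_nat_recr k.+1)//= [leRHS]lnM ?posrE.
  - by rewrite lerD2r.
  - exact: lt_le_trans rk.
  by rewrite ltr_pwDl// l_ge0.
have start : d2 (Kprod K m x) (mun mu0 K m) ^+ 2 <= expR 2.
  have norm_le : avg (mun mu0 K m) (fun y => density mu0 K x m y ^+ 2) <= expR 2.
    apply: density_norm_le => // [|f f0]; first by have := @expR_ge1Dx R 2; lra.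
    apply: (act_Kprod_le mK _ mu1 l_ge0) => // y; exact: ltW.
  (* The density has mean 1, so the squared distance is its variance, at most its second moment. *)
  rewrite d2E// avg_sqrB ?mun_sum1// avg_density1// subrr expr0n addr0.
  by apply: le_trans norm_le; rewrite gerBl sqr_ge0.
elim: n mn => [|n IH].
  rewrite leqn0 => /eqP m0; move: start; rewrite m0 big_geq// mulr1.
  exact.
rewrite leq_eqVlt => /predU1P[<-|mn]; first by rewrite big_geq// mulr1.
rewrite big_nat_recr//= mulrA.
have step := d2_step mK mu1 mun_gt0 x C1 (pi_gt0 _ (ltn0Sn n)) (piK _ (ltn0Sn n))
  (sv _ (ltn0Sn n)) (piC _ n (ltn0Sn n)) (muC _ n.+1 (ltn0Sn n)).
apply: (le_trans step); rewrite -cC mulrC ler_wpM2r ?IH//.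
(* The new factor equals [1 - c ^- 4 + c ^- 4 * sigma1 n.+1 ^+ 2]; its nonnegativity allows the
   induction hypothesis to be multiplied by it. *)
have s2 : 0 <= c ^- 4 * sigma1 n.+1 ^+ 2.
  by rewrite mulr_ge0 ?sqr_ge0// invr_ge0 exprn_ge0// ltW.
have c4 : c ^- 4 <= 1 by rewrite invf_le1 ?exprn_gt0// exprn_ege1// ltW.
by rewrite mulrBr mulr1; lra.
Qed.
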